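(* Let $(\mathcal X,Q,\pi)$ be a reversible Markov chain. Let $\phi:[0,\infty)\to\mathbb R$ be strictly increasing, $C^\infty$ on $(0,\infty)$ and continuous at $0$. Let $f:[0,\infty)\to\mathbb R$ be strictly convex, $C^\infty$ on $(0,\infty)$ and continuous at $0$, and assume that the function $$\theta(r,s)=\frac{\phi(r)-\phi(s)}{f'(r)-f'(s)}\qquad(r\neq s)$$ extends to a weight function on $[0,\infty)\times[0,\infty)$, still denoted $\theta$. Let $\mathcal W$ be the non-local transportation metric on $\mathscr P(\mathcal X)$ induced by $\theta$, and let $\mathcal F(\rho)=\sum_{x\in\mathcal X}f(\rho(x))\pi(x)$. Then the gradient flow equation of $\mathcal F$ with respect to (the Riemannian structure of) $\mathcal W$ on $\mathscr P_*(\mathcal X)$ is the discrete porous medium equation $$\partial_t\rho_t=\Delta\phi(\rho_t).$$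
   Context: **Markov chain.** A reversible Markov chain $(\mathcal X,Q,\pi)$ consists of a finite set $\mathcal X$, a matrix $Q:\mathcal X\times\mathcal X\to\mathbb R$ with $Q(x,y)\ge 0$ for $x\ne y$ and $\sum_{y}Q(x,y)=0$ for all $x$, which is irreducible (for all $x,y$ there are $n\ge1$ and $x=x_0,\dots,x_n=y$ with $Q(x_{i-1},x_i)>0$ for all $i$), and its unique stationary probability measure $\pi$, assumed to satisfy $Q(x,y)\pi(x)=Q(y,x)\pi(y)$ for all $x,y$. The discrete Laplacian is $\Delta\psi(x)=\sum_{y}Q(x,y)(\psi(y)-\psi(x))$; $\phi(\rho)$ denotes $x\mapsto \phi(\rho(x))$. $\mathscr P(\mathcal X)=\{\rho:\mathcal X\to[0,\infty):\sum_x\rho(x)\pi(x)=1\}$ and $\mathscr P_*(\mathcal X)=\{\rho\in\mathscr P(\mathcal X):\rho(x)>0\ \forall x\}$. **Weight function.** A function $\theta:[0,\infty)\times[0,\infty)\to[0,\infty)$ that is continuous on $[0,\infty)^2$ and $C^\infty$ on $(0,\infty)^2$; symmetric; positive on $(0,\infty)^2$; satisfies $\theta(r,s)\le\theta(r,t)$ for $r\ge0$, $0\le s\le t$; and is concave. Write $\hat\rho(x,y)=\theta(\rho(x),\rho(y))$. **Metric.** $\mathcal W(\bar\rho_0,\bar\rho_1)^2$ is the infimum of $\int_0^1\frac12\sum_{x,y}(\psi_t(y)-\psi_t(x))^2\hat\rho_t(x,y)Q(x,y)\pi(x)\,dt$ over all pairs $(\rho,\psi)$ with $\rho:[0,1]\to\mathbb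 R^{\mathcal X}$ of class $C^\infty$, $\rho_t\in\mathscr P(\mathcal X)$ for all $t$, $\rho_0=\bar\rho_0$, $\rho_1=\bar\rho_1$, $\psi:[0,1]\to\mathbb R^{\mathcal X}$ measurable, and satisfying the continuity equation $\partial_t\rho_t(x)+\sum_y(\psi_t(y)-\psi_t(x))\hat\rho_t(x,y)Q(x,y)=0$ for all $x\in\mathcal X$, $t\in(0,1)$. **Riemannian structure and gradient flow.** Let $\nabla\psi(x,y)=\psi(y)-\psi(x)$ and, for $\Psi:\mathcal X\times\mathcal X\to\mathbb R$, $(\nabla\cdot\Psi)(x)=\frac12\sum_y(\Psi(x,y)-\Psi(y,x))Q(x,y)$. The continuity equation reads $\partial_t\rho_t+\nabla\cdot(\hat\rho_t\nabla\psi_t)=0$. The restriction of $\mathcal W$ to $\mathscr P_*(\mathcal X)$ is the Riemannian distance of the following structure: the tangent space at $\rho\in\mathscr P_*(\mathcal X)$ is $T_\rho=\{\nabla\psi:\psi\in\mathbb R^{\mathcal X}\}$, where the tangent vector of a smooth curve $(\rho_t)$ in $\mathscr P_*(\mathcal X)$ at time $t$ is identified with the unique $\nabla\psi_t$ satisfying the continuity equation at time $t$; the inner product on $T_\rho$ is $\langle\nabla\varphi,\nabla\psi\rangle_\rho=\frac12\sum_{x,y}\nabla\varphi(x,y)\nabla\psi(x,y)\hat\rho(x,y)Q(x,y)\pi(x)$. The gradient $\operatorname{grad}_{\mathcal W}\mathcal F(\rho)\in T_\rho$ is taken with respect to this structure, and the gradient flow equation of $\mathcal F$ for curves in $\mathscr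 P_*(\mathcal X)$ is: $\partial_t\rho_t+\nabla\cdot(\hat\rho_t\nabla\psi_t)=0$ with $\nabla\psi_t=-\operatorname{grad}_{\mathcal W}\mathcal F(\rho_t)$. *)

(* Defs.v *)
From mathcomp Require Import all_boot all_order all_algebra.
From mathcomp Require Import all_classical all_reals all_analysis.
Set Implicit Arguments.
Unset Strict Implicit.
Unset Printing Implicit Defensive.
Import Order.TTheory GRing.Theory Num.Theory.
Import numFieldNormedType.Exports.
Local Open Scope classical_set_scope.
Local Open Scope ring_scope.

(* C^infty on the open set U, also for functions of several real variables:
   every iterated directional derivative of f is differentiable on U. *)
Definition smooth_on (R : realType) (V : normedModType R) (U : set V)
    (f : V -> R) : Prop :=
  forall (vs : seq V) (x : V), U x ->
    differentiable (foldr (fun v g => 'D_v g) f vs) x.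

Definition strictly_convex_on (R : realType) (D : set R) (f : R -> R) : Prop :=
  forall r s a : R, D r -> D s -> r != s -> 0 < a < 1 ->
    f (a * r + (1 - a) * s) < a * f r + (1 - a) * f s.

(* A function on [0, +oo[ (resp. on [0, +oo[ x [0, +oo[) is represented by a
   total function on R (resp. R x R) whose values elsewhere are never used. *)
Record weight_function (R : realType) (theta : R -> R -> R) : Prop := {
  weight_ge0 : forall r s : R, 0 <= r -> 0 <= s -> 0 <= theta r s;
  weight_continuous :
    {within [set p : R * R | 0 <= p.1 /\ 0 <= p.2],
      continuous (fun p : R * R => theta p.1 p.2)};
  weight_smooth :
    smooth_on [set p : R * R | 0 < p.1 /\ 0 < p.2]
      (fun p : R * R => theta p.1 p.2);
  weight_sym : forall r s : R, 0 <= r -> 0 <= s -> theta r s = theta s r;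
  weight_gt0 : forall r s : R, 0 < r -> 0 < s -> 0 < theta r s;
  weight_le : forall r s t : R,
    0 <= r -> 0 <= s -> s <= t -> theta r s <= theta r t;
  weight_concave : forall r s r' s' a : R,
    0 <= r -> 0 <= s -> 0 <= r' -> 0 <= s' -> 0 <= a <= 1 ->
    a * theta r s + (1 - a) * theta r' s' <=
      theta (a * r + (1 - a) * r') (a * s + (1 - a) * s')
}.

Record reversible_markov_chain (R : realType) (X : finType)
    (Q : X -> X -> R) (mu : X -> R) : Prop := {
  chain_offdiag_ge0 : forall x y : X, x != y -> 0 <= Q x y;
  chain_row_sum0 : forall x : X, \sum_y Q x y = 0;
  chain_irreducible : forall x y : X, exists s : seq X,
    [/\ (0 < size s)%N, path (fun u v => 0 < Q u v) x s & last x s = y];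
  chain_measure_ge0 : forall x : X, 0 <= mu x;
  chain_measure_sum1 : \sum_x mu x = 1;
  chain_stationary : forall y : X, \sum_x mu x * Q x y = 0;
  chain_detailed_balance : forall x y : X, Q x y * mu x = Q y x * mu y
}.

Section Transport.
Variables (R : realType) (X : finType) (Q : X -> X -> R) (mu : X -> R).
Variable theta : R -> R -> R.

Definition laplacian (psi : X -> R) (x : X) : R :=
  \sum_y Q x y * (psi y - psi x).

Definition density (rho : X -> R) : Prop :=
  (forall x, 0 <= rho x) /\ \sum_x rho x * mu x = 1.

Definition positive_density (rho : X -> R) : Prop :=
  density rho /\ forall x, 0 < rho x.

Definition dgrad (psi : X -> R) (x y : X) : R := psi y - psi x.

Definition ddiv (Psi : X -> X -> R) (x : X) : R :=
  2^-1 * \sum_y (Psi x y - Psi y x) * Q x y.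

Definition edge_weight (rho : X -> R) (x y : X) : R := theta (rho x) (rho y).

Definition tangent_space : set (X -> X -> R) := range dgrad.

(* The action minimised in the definition of the transport metric W is the
   energy of a curve for this scalar product. *)
Definition riemannian_inner (rho : X -> R) (Phi Psi : X -> X -> R) : R :=
  2^-1 * \sum_x \sum_y
    Phi x y * Psi x y * edge_weight rho x y * Q x y * mu x.

(* Continuity equation at time t, including the existence of the time
   derivative. *)
Definition continuity_equation (rho : R -> X -> R) (t : R)
    (Psi : X -> X -> R) : Prop :=
  forall x, derivable (rho ^~ x) t 1 /\
    derive1 (rho ^~ x) t +
      ddiv (fun u v => edge_weight (rho t) u v * Psi u v) x = 0.

Definition smooth_curve (I : set R) (rho : R -> X -> R) : Prop :=
  (forall t, I t -> positive_density (rho t)) /\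
  forall x, smooth_on I (rho ^~ x).

Definition tangent_vector (rho : R -> X -> R) (t : R)
    (Psi : X -> X -> R) : Prop :=
  tangent_space Psi /\ continuity_equation rho t Psi.

(* Psi is the Riemannian gradient of F at rho: it represents, for the scalar
   product at rho, the derivative of F along all smooth curves through rho. *)
Definition is_gradient (F : (X -> R) -> R) (rho : X -> R)
    (Psi : X -> X -> R) : Prop :=
  tangent_space Psi /\
  forall (e : R) (gamma : R -> X -> R) (Phi : X -> X -> R),
    0 < e -> smooth_curve `](- e), e[ gamma -> gamma 0 = rho ->
    tangent_vector gamma 0 Phi ->
    is_derive (0 : R) (1 : R) (F \o gamma) (riemannian_inner rho Psi Phi).

Definition gradient_flow (F : (X -> R) -> R) (I : set R)
    (rho : R -> X -> R) : Prop :=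
  forall t, I t -> exists Psi : X -> X -> R,
    is_gradient F (rho t) Psi /\
    continuity_equation rho t (fun x y => - Psi x y).

Definition porous_medium_equation (phi : R -> R) (I : set R)
    (rho : R -> X -> R) : Prop :=
  forall t, I t -> forall x, derivable (rho ^~ x) t 1 /\
    derive1 (rho ^~ x) t = laplacian (fun y => phi (rho t y)) x.

Definition internal_energy (f : R -> R) (rho : X -> R) : R :=
  \sum_x f (rho x) * mu x.

End Transport.

(* Main.v *)
Require Import Defs.
From mathcomp Require Import all_boot all_order all_algebra.
From mathcomp Require Import all_classical all_reals all_analysis.
From mathcomp Require Import ring lra.
Import Order.TTheory GRing.Theory Num.Theory.
Import numFieldNormedType.Exports.
Local Open Scope classical_set_scope.
Local Open Scope ring_scope.

(** The gradient of the energy is the discrete gradient of [f' o rho].  Along a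
    curve with tangent [Phi] the chain rule, the continuity equation and
    summation by parts (which is where detailed balance enters) give
<<
      d/dt F(rho) = sum_x f'(rho x) (d/dt rho x) mu x
                  = - sum_x f'(rho x) ddiv (w Phi) x mu x
                  = < dgrad (f' o rho), Phi >_rho ,
>>
    [w] being the edge weight of [rho]: this is [energy_gradient].  The choice
    of [theta] is made precisely so that [w] turns the differences of [f'] into
    differences of [phi] ([weight_derivative_diff]); hence the divergence of
    the weighted gradient is [laplacian phi(rho)] ([ddiv_weighted_gradient]),
    and the continuity equation for minus the gradient is the porous medium
    equation.

    This shows at once that a solution of the porous medium equation is a
    gradient flow.  The converse needs the gradient to be unique
    ([gradient_unique]), since a gradient flow comes with some representative
    of the differential of the energy.  Every discrete gradient is the tangent
    of an affine curve of positive densities ([gradient_tangent_curve]), so the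
    difference of two representatives is orthogonal to the whole tangent space,
    in particular to itself.  The scalar product is definite on gradients
    because the edge weights are positive, [mu] charges every state and the
    chain is irreducible ([riemannian_inner_definite]). *)

(** * Reversible chains and summation by parts *)

Section Chain.
Set Implicit Arguments.
Unset Strict Implicit.
Variables (R : realType) (X : finType) (Q : X -> X -> R) (mu : X -> R).
Hypothesis chain : reversible_markov_chain Q mu.

Lemma chain_propagate (P : X -> Prop) (x y : X) :
  (forall u v, 0 < Q u v -> P u -> P v) -> P x -> P y.
Proof.
move=> step; have [s [_ + <-]] := chain_irreducible chain x y.
by elim: s x => //= z s IH x /andP[xz zs] /(step _ _ xz); apply: IH.
Qed.

(** Some state has positive mass, and detailed balance carries positivity of
    the mass along the edges. *)
Lemma chain_measure_gt0 (y : X) : 0 < mu y.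
Proof.
have [x mux] : exists x, 0 < mu x.
  apply: contrapT => /forallNP mu0; have := chain_measure_sum1 chain.
  rewrite big1 => [|x _]; first by move/eqP; rewrite eq_sym oner_eq0.
  apply/eqP; rewrite eq_le (chain_measure_ge0 chain) andbT leNgt.
  by apply/negP; exact: mu0.
apply: (chain_propagate (P := fun z => 0 < mu z) _ _ mux) => u v uv muu.
rewrite lt_def (chain_measure_ge0 chain) andbT; apply/eqP => muv.
have := chain_detailed_balance chain u v; rewrite muv mulr0.
by apply/eqP; rewrite mulf_neq0 ?gt_eqF.
Qed.

(** Reversibility makes [ddiv] the negative adjoint of [dgrad]; the flux need
    not be antisymmetric, because [ddiv] antisymmetrises it. *)
Lemma sum_ddiv_by_parts (psi : X -> R) (Psi : X -> X -> R) :
  \sum_x psi x * ddiv Q Psi x * mu x =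
  - (2^-1 * \sum_x \sum_y dgrad psi x y * Psi x y * Q x y * mu x).
Proof.
have expand : \sum_x psi x * ddiv Q Psi x * mu x =
  2^-1 * (\sum_x \sum_y psi x * Psi x y * Q x y * mu x -
          \sum_x \sum_y psi x * Psi y x * Q x y * mu x).
  rewrite -sumrB mulr_sumr; apply: eq_bigr => x _.
  rewrite /ddiv -sumrB mulrCA -mulrA mulr_sumr mulr_suml; congr (_ * _).
  by apply: eq_bigr => y _; ring.
rewrite expand -mulrN; congr (_ * _).
rewrite [X in _ - X]exchange_big /= -sumrB -sumrN; apply: eq_bigr => x _.
rewrite -sumrB -sumrN; apply: eq_bigr => y _; rewrite /dgrad.
by rewrite -[in X in _ - X]mulrA (chain_detailed_balance chain y x); ring.
Qed.

Lemma sum_ddiv_eq0 (Psi : X -> X -> R) : \sum_x ddiv Q Psi x * mu x = 0.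
Proof.
have := sum_ddiv_by_parts (fun=> 1) Psi.
under eq_bigr do rewrite mul1r.
move=> ->; rewrite big1 ?mulr0 ?oppr0 // => x _.
by rewrite big1 // => y _; rewrite /dgrad subrr !mul0r.
Qed.

Lemma riemannian_inner_dgrad (theta : R -> R -> R) (sigma psi : X -> R)
    (Phi : X -> X -> R) :
  riemannian_inner Q mu theta sigma (dgrad psi) Phi =
  - \sum_x psi x *
      ddiv Q (fun u v => edge_weight theta sigma u v * Phi u v) x * mu x.
Proof.
rewrite sum_ddiv_by_parts opprK /riemannian_inner; congr (_ * _).
by do 2![apply: eq_bigr => ? _]; ring.
Qed.

(** A vanishing sum of nonnegative terms makes [psi] constant along every edge
    with positive rate, hence constant by irreducibility. *)
Lemma riemannian_inner_definite (theta : R -> R -> R) (sigma : X -> R)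
    (Phi : X -> X -> R) :
  (forall r s, 0 < r -> 0 < s -> 0 < theta r s) -> (forall x, 0 < sigma x) ->
  tangent_space Phi -> riemannian_inner Q mu theta sigma Phi Phi = 0 ->
  Phi = fun _ _ => 0.
Proof.
move=> theta_gt0 sigma_gt0 [psi _ <-] /eqP.
have term_ge0 x y : 0 <= dgrad psi x y * dgrad psi x y *
    edge_weight theta sigma x y * Q x y * mu x.
  have [<-|xy] := eqVneq x y; first by rewrite /dgrad subrr !mul0r.
  rewrite -expr2; apply/mulr_ge0/ltW/chain_measure_gt0.
  apply/mulr_ge0/(chain_offdiag_ge0 chain xy)/mulr_ge0; first exact: sqr_ge0.
  exact/ltW/theta_gt0.
rewrite mulf_eq0 invr_eq0 pnatr_eq0 /= => /eqP null.
have edge x y : 0 < Q x y -> psi x = psi y.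
  move=> xy.
  have row : \sum_z dgrad psi x z * dgrad psi x z *
      edge_weight theta sigma x z * Q x z * mu x = 0.
    by apply: (psumr_eq0P _ null) => // u _; apply: sumr_ge0.
  have /eqP := @psumr_eq0P _ _ _ _ (fun z _ => term_ge0 x z) row y isT.
  rewrite !mulf_eq0 !(gt_eqF xy) (gt_eqF (chain_measure_gt0 x)).
  by rewrite (gt_eqF (theta_gt0 _ _ _ _)) // !orbF orbb subr_eq0 => /eqP.
apply/funext => x; apply/funext => y; apply/eqP; rewrite subr_eq0; apply/eqP.
by apply: (chain_propagate (P := fun z => psi z = psi x) (x := x)) => // u v /edge ->.
Qed.

End Chain.

(** * Affine curves and the chain rule *)

Section Curves.
Set Implicit Arguments.
Unset Strict Implicit.
Variable R : realType.

Lemma is_derive_affine (a b t v : R) :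
  is_derive t v (fun s : R => a + s * b) (v * b).
Proof.
have -> : (fun s : R => a + s * b) = cst a + b \*: (id : R -> R).
  by apply/funext => s; rewrite !fctE mulrC.
by apply: is_derive_eq; rewrite add0r mulrC.
Qed.

Lemma smooth_on_affine (U : set R) (a b : R) :
  smooth_on U (fun s : R => a + s * b).
Proof.
move=> vs t _.
have [c [d ->]] : exists c d : R,
    foldr (fun v (g : R -> R) => 'D_v g) (fun s : R => a + s * b) vs =
    (fun s : R => c + s * d).
  elim: vs => [|v vs [c [d IH]]] /=; first by exists a, b.
  exists (v * d), 0; apply/funext => s; rewrite IH mulr0 addr0.
  by have := is_derive_affine c d s v => h; rewrite derive_val.
by apply/derivable1_diffP; have := is_derive_affine c d t 1; case.
Qed.

Lemma positive_density_affine_curve (X : finType) (mu sigma v : X -> R) :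
  positive_density mu sigma -> \sum_x v x * mu x = 0 ->
  exists2 e : R, 0 < e &
    smooth_curve mu `](- e), e[ (fun t x => sigma x + t * v x).
Proof.
move=> [[_ mass1] sigma_gt0] v0.
pose S := \sum_x `|v x| / sigma x.
have S_ge0 : 0 <= S.
  by apply: sumr_ge0 => x _; rewrite divr_ge0 // ltW.
have S1_gt0 : 0 < 1 + S by rewrite ltr_pwDl.
(* For |t| < 1 / (1 + S) one has |t v x| < sigma x, as |v x| <= S sigma x. *)
exists (1 + S)^-1; first by rewrite invr_gt0.
split=> [t tI|x]; last exact: smooth_on_affine.
have t_lt : `|t| < (1 + S)^-1 by move: tI; rewrite /= in_itv /= ltr_norml.
have pos x : 0 < sigma x + t * v x.
  have vS : `|v x| <= S * sigma x.
    rewrite -ler_pdivrMr // /S (bigD1 x) //= lerDl.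
    by apply: sumr_ge0 => y _; rewrite divr_ge0 // ltW.
  have tS : `|t| * (1 + S) < 1 by rewrite -ltr_pdivlMr // div1r.
  suff : `|t * v x| < sigma x by rewrite ltr_norml => /andP[+ _]; lra.
  rewrite normrM; apply: (@le_lt_trans _ _ (`|t| * (S * sigma x))).
    by apply: ler_wpM2l.
  rewrite mulrA gtr_pMl //; apply: le_lt_trans tS.
  by rewrite ler_wpM2l // lerDr.
split=> //; split=> [x|]; first exact: ltW.
under eq_bigr do rewrite mulrDl -mulrA.
by rewrite big_split /= mass1 -mulr_sumr v0 mulr0 addr0.
Qed.

Lemma is_derive_bigsum (I : Type) (s : seq I) (h : I -> R -> R) (dh : I -> R)
    (t v : R) :
  (forall i, is_derive t v (h i) (dh i)) ->
  is_derive t v (fun u => \sum_(i <- s) h i u) (\sum_(i <- s) dh i).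
Proof.
move=> dhP; elim: s => [|i s IH].
  under [fun u => _]funext do rewrite big_nil.
  by rewrite big_nil; exact: is_derive_cst.
under [fun u => _]funext do rewrite big_cons.
by rewrite big_cons; exact: (is_deriveD (dhP i) IH).
Qed.

Lemma is_derive_internal_energy (X : finType) (mu : X -> R) (f : R -> R)
    (gamma : R -> X -> R) (t : R) :
  (forall x, derivable (gamma ^~ x) t 1) ->
  (forall x, derivable f (gamma t x) 1) ->
  is_derive t (1 : R) (internal_energy mu f \o gamma)
    (\sum_x derive1 f (gamma t x) * derive1 (gamma ^~ x) t * mu x).
Proof.
move=> dgamma df; apply: is_derive_bigsum => x.
have dfx : is_derive (gamma t x) (1 : R) f (derive1 f (gamma t x)).
  by rewrite derive1E; exact: derivableP.
have dgx : is_derive t (1 : R) (gamma ^~ x) (derive1 (gamma ^~ x) t).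
  by rewrite derive1E; exact: derivableP.
have := is_deriveZ (mu x) (is_derive1_comp dfx dgx).
rewrite [_ *: _]mulrC.
by congr (is_derive _ _ _ _); apply/funext => u; rewrite /= [LHS]mulrC.
Qed.

End Curves.

(** * Gradients for the transport structure *)

Section Gradient.
Set Implicit Arguments.
Unset Strict Implicit.
Variables (R : realType) (X : finType) (Q : X -> X -> R) (mu : X -> R).
Variable theta : R -> R -> R.
Hypothesis chain : reversible_markov_chain Q mu.

(** Going straight in the direction prescribed by the continuity equation
    preserves the total mass, a divergence having zero mean. *)
Lemma gradient_tangent_curve (sigma : X -> R) (Phi : X -> X -> R) :
  positive_density mu sigma -> tangent_space Phi ->
  exists (e : R) (gamma : R -> X -> R),
    [/\ 0 < e, smooth_curve mu `](- e), e[ gamma, gamma 0 = sigma &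
        tangent_vector Q theta gamma 0 Phi].
Proof.
move=> dens tPhi.
pose v x := - ddiv Q (fun a b => edge_weight theta sigma a b * Phi a b) x.
have v0 : \sum_x v x * mu x = 0.
  under eq_bigr do rewrite mulNr.
  by rewrite sumrN (sum_ddiv_eq0 chain) oppr0.
have [e e0 smooth] := positive_density_affine_curve dens v0.
have g0 : (fun x => sigma x + 0 * v x) = sigma.
  by apply/funext => x; rewrite mul0r addr0.
exists e, (fun t x => sigma x + t * v x); split=> //; split=> // x.
have := is_derive_affine (sigma x) (v x) 0 1 => h; split; first by case: h.
by rewrite derive1E derive_val mul1r g0 addNr.
Qed.

(** The difference of two gradients is itself a tangent vector, so it can be
    tested against itself. *)
Lemma gradient_unique (F : (X -> R) -> R) (sigma : X -> R)
    (Psi1 Psi2 : X -> X -> R) :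
  (forall r s, 0 < r -> 0 < s -> 0 < theta r s) -> positive_density mu sigma ->
  is_gradient Q mu theta F sigma Psi1 -> is_gradient Q mu theta F sigma Psi2 ->
  Psi1 = Psi2.
Proof.
move=> theta_gt0 dens [[psi1 _ def1] grad1] [[psi2 _ def2] grad2].
pose Phi x y := Psi1 x y - Psi2 x y.
have tPhi : tangent_space Phi.
  exists (fun x => psi1 x - psi2 x) => //.
  by rewrite /Phi -def1 -def2 /dgrad; do 2!apply/funext => ?; ring.
have [e [gamma [e0 smooth gamma0 tangent]]] :=
  gradient_tangent_curve dens tPhi.
have d1 := grad1 _ _ _ e0 smooth gamma0 tangent.
have d2 := grad2 _ _ _ e0 smooth gamma0 tangent.
have eq12 : riemannian_inner Q mu theta sigma Psi1 Phi =
            riemannian_inner Q mu theta sigma Psi2 Phi.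
  by rewrite -(@derive_val _ _ _ _ _ _ _ d1) -(@derive_val _ _ _ _ _ _ _ d2).
have null : riemannian_inner Q mu theta sigma Phi Phi = 0.
  rewrite -(subrr (riemannian_inner Q mu theta sigma Psi2 Phi)) -{1}eq12.
  rewrite /riemannian_inner -mulrBr -sumrB; congr (_ * _).
  apply: eq_bigr => x _; rewrite -sumrB.
  by apply: eq_bigr => y _; rewrite /Phi; ring.
have Phi0 := riemannian_inner_definite chain theta_gt0 dens.2 tPhi null.
apply/funext => x; apply/funext => y; apply/eqP.
by rewrite -subr_eq0 -/(Phi x y) Phi0.
Qed.

Lemma energy_gradient (f : R -> R) (sigma : X -> R) :
  (forall r, 0 < r -> derivable f r 1) -> (forall x, 0 < sigma x) ->
  is_gradient Q mu theta (internal_energy mu f) sigma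
    (dgrad (fun x => derive1 f (sigma x))).
Proof.
move=> df sigma_gt0; split; first by eexists.
move=> e gamma Phi _ _ gamma0 [_ cont].
have := @is_derive_internal_energy _ _ mu f gamma 0.
rewrite gamma0 => /(_ (fun x => (cont x).1) (fun x => df _ (sigma_gt0 x))).
congr (is_derive _ _ _ _); rewrite (riemannian_inner_dgrad chain) -sumrN.
apply: eq_bigr => x _; have /eqP := (cont x).2.
by rewrite gamma0 addr_eq0 => /eqP ->; ring.
Qed.

End Gradient.

(** * The defining quotient of the weight *)

Section PorousMedium.
Set Implicit Arguments.
Unset Strict Implicit.
Variables (R : realType) (phi f : R -> R) (theta : R -> R -> R).
Hypothesis theta_gt0 : forall r s, 0 < r -> 0 < s -> 0 < theta r s.
Hypothesis theta_sym : forall r s, 0 <= r -> 0 <= s -> theta r s = theta s r.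
Hypothesis theta_quotient : forall r s : R, 0 < r -> 0 < s -> r != s ->
  theta r s = (phi r - phi s) / (derive1 f r - derive1 f s).

(** Since [theta] is positive, the denominator of its defining quotient cannot
    vanish off the diagonal; on the diagonal both sides are zero whatever the
    value of [theta]. *)
Lemma weight_derivative_diff (r s : R) : 0 < r -> 0 < s ->
  theta r s * (derive1 f r - derive1 f s) = phi r - phi s.
Proof.
move=> r0 s0; have [->|rs] := eqVneq r s; first by rewrite !subrr mulr0.
have quot := theta_quotient r0 s0 rs; rewrite quot divfK //.
apply/eqP => den0; have := theta_gt0 r0 s0.
by rewrite quot den0 invr0 mulr0 ltxx.
Qed.

Lemma ddiv_weighted_gradient (X : finType) (Q : X -> X -> R) (sigma : X -> R) :
  (forall x, 0 < sigma x) ->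
  ddiv Q (fun u v => edge_weight theta sigma u v *
                     - dgrad (fun x => derive1 f (sigma x)) u v) =
  fun x => - laplacian Q (fun y => phi (sigma y)) x.
Proof.
move=> sigma_gt0; apply/funext => x.
have flux u v : edge_weight theta sigma u v *
    - dgrad (fun x => derive1 f (sigma x)) u v = phi (sigma u) - phi (sigma v).
  by rewrite -weight_derivative_diff // /dgrad opprB.
rewrite /ddiv /laplacian -sumrN mulr_sumr; apply: eq_bigr => y _.
by rewrite !flux; field.
Qed.

End PorousMedium.

Theorem theorem1p1 (R : realType) (X : finType) (Q : X -> X -> R)
  (mu : X -> R) (phi f : R -> R) (theta : R -> R -> R) :
  reversible_markov_chain Q mu ->
  (forall r s : R, 0 <= r -> r < s -> phi r < phi s) ->
  smooth_on [set r : R | 0 < r] phi ->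
  phi r @[r --> 0^'+] --> phi 0 ->
  strictly_convex_on [set r : R | 0 <= r] f ->
  smooth_on [set r : R | 0 < r] f ->
  f r @[r --> 0^'+] --> f 0 ->
  weight_function theta ->
  (forall r s : R, 0 < r -> 0 < s -> r != s ->
    theta r s = (phi r - phi s) / (derive1 f r - derive1 f s)) ->
  forall (I : set R) (rho : R -> X -> R),
    open I -> is_interval I ->
    (forall t, I t -> positive_density mu (rho t)) ->
    (gradient_flow Q mu theta (internal_energy mu f) I rho <->
     porous_medium_equation Q phi I rho).
Proof.
move=> chain _ _ _ _ smooth_f _ weight quot I rho _ _ dens.
have theta_gt0 := weight_gt0 weight.
have df r : 0 < r -> derivable f r 1.
  by move=> r0; apply/derivable1_diffP; exact: (smooth_f [::] r r0).
have grad t (It : I t) :=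
  energy_gradient theta chain df (dens t It).2.
have flux t (It : I t) :=
  ddiv_weighted_gradient theta_gt0 quot Q (dens t It).2.
split=> [flow t It x | pme t It].
  have [Psi [gradPsi cont]] := flow t It.
  have PsiE := gradient_unique chain theta_gt0 (dens t It) gradPsi
    (grad t It).
  have [dx] := cont x; rewrite PsiE flux // => /eqP.
  by rewrite subr_eq0 => /eqP.
exists (dgrad (fun x => derive1 f (rho t x))); split; first exact: grad.
by move=> x; have [dx eqx] := pme t It x; rewrite flux // eqx subrr.
Qed.
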